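(* The category $\mathbf{App}$ of approach spaces is fully embedded into the category $\mathbf{ProbApp}$ of probabilistic approach spaces as a reflective and coreflective subcategory.
   Context: $\mathsf PX$ is the power set of $X$. $\mathbf{App}$: objects are sets $X$ with a function $\delta:X\times\mathsf PX\to[0,\infty]$ such that for all $x\in X$, $A,B\subseteq X$, $\varepsilon\in[0,\infty]$: $\delta(x,\{x\})=0$; $\delta(x,\emptyset)=\infty$; $\delta(x,A\cup B)=\min\{\delta(x,A),\delta(x,B)\}$; $\delta(x,A)\le\delta(x,A^{(\varepsilon)})+\varepsilon$, where $A^{(\varepsilon)}=\{y\in X\mid\delta(y,A)\le\varepsilon\}$. Morphisms $f:(X,\delta)\to(Y,\epsilon)$ are (contractive) maps with $\epsilon(f(x),f(A))\le\delta(x,A)$ for all $x\in X$, $A\subseteq X$. $\mathbf\Delta$ is the quantale of all $\varphi:[0,\infty]\to[0,1]$ with $\varphi(\beta)=\sup_{\alpha<\beta}\varphi(\alpha)$ for all $\beta\in[0,\infty]$, ordered pointwise, with $(\varphi\odot\psi)(\gamma)=\sup_{\alpha+\beta\le\gamma}\varphi(\alpha)\psi(\beta)$ and neutral element $\kappa$ given by $\kappa(0)=0$, $\kappa(\alpha)=1$ for $\alpha>0$; its bottom element is the constant function $0$. $\mathbf{ProbApp}$: objects are sets $X$ with a function $\delta:X\times\mathsf PX\to\mathbf\Delta$ such that for all $x\in X$, $A,B\subseteq X$, $\varphi\in\mathbf\Delta$: $\delta(x,\{x\})=\kappa$; $\delta(x,\emptyset)=0$; $\delta(x,A\cup B)=\delta(x,A)\vee\delta(x,B)$;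 $\delta(x,A)\ge\delta(x,A^{(\varphi)})\odot\varphi$, where $A^{(\varphi)}=\{y\in X\mid\delta(y,A)\ge\varphi\}$. Morphisms $f:(X,\delta)\to(Y,\epsilon)$ are maps with $\delta(x,A)\le\epsilon(f(x),f(A))$ for all $x\in X$, $A\subseteq X$. ''Fully embedded as a reflective and coreflective subcategory'' means: there is a full and faithful functor $\mathbf{App}\to\mathbf{ProbApp}$, injective on objects, which has both a left adjoint and a right adjoint. *)

(* Defs.v *)
From mathcomp Require Import all_boot all_order all_algebra.
From mathcomp Require Import all_classical all_reals.
From mathcomp Require Import lra.

Set Implicit Arguments.
Unset Strict Implicit.
Unset Printing Implicit Defensive.

Import Order.TTheory GRing.Theory Num.Theory.
Local Open Scope classical_set_scope.
Local Open Scope ring_scope.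

Record category := Category {
  obj :> Type;
  hom : obj -> obj -> Type;
  idm : forall X, hom X X;
  compm : forall X Y Z, hom Y Z -> hom X Y -> hom X Z;
  compmA : forall X Y Z W (h : hom Z W) (g : hom Y Z) (f : hom X Y),
    compm h (compm g f) = compm (compm h g) f;
  comp1m : forall X Y (f : hom X Y), compm (idm Y) f = f;
  compm1 : forall X Y (f : hom X Y), compm f (idm X) = f
}.
Arguments hom {c} _ _.
Arguments idm {c} _.
Arguments compm {c X Y Z} _ _.

Record functor (C D : category) := Functor {
  fobj :> C -> D;
  fhom : forall X Y, hom X Y -> hom (fobj X) (fobj Y);
  fhom1 : forall X, fhom (idm X) = idm (fobj X);
  fhomM : forall X Y Z (g : hom Y Z) (f : hom X Y),
    fhom (compm g f) = compm (fhom g) (fhom f)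
}.
Arguments fhom {C D} _ {X Y} _.

Definition faithful (C D : category) (F : functor C D) : Prop :=
  forall X Y : C, injective (@fhom C D F X Y).

Definition full (C D : category) (F : functor C D) : Prop :=
  forall (X Y : C) (g : hom (F X) (F Y)), exists f : hom X Y, fhom F f = g.

(* L is left adjoint to G: hom(L X, Y) and hom(X, G Y) are in bijection,
   naturally in X and Y. *)
Definition adjoint (C D : category) (L : functor C D) (G : functor D C) : Prop :=
  exists Phi : forall (X : C) (Y : D), hom (L X) Y -> hom X (G Y),
    (forall X Y, bijective (@Phi X Y)) /\
    (forall (X X' : C) (Y Y' : D) (h : hom X' X) (k : hom Y Y')
       (f : hom (L X) Y),
       Phi X' Y' (compm k (compm f (fhom L h)))
         = compm (fhom G k) (compm (Phi X Y f) h)).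

Definition has_left_adjoint (C D : category) (F : functor C D) : Prop :=
  exists L : functor D C, adjoint L F.

Definition has_right_adjoint (C D : category) (F : functor C D) : Prop :=
  exists G : functor D C, adjoint F G.

Record ennreal (R : realType) := ENNReal {
  enn : \bar R;
  enn_ge0 : (0 <= enn)%E
}.

Lemma enn_inj (R : realType) : injective (@enn R).
Proof.
by move=> [a a0] [b b0] /= ab; move: a0 b0; rewrite ab => a0 b0;
  rewrite (bool_irrelevance a0 b0).
Qed.

Record app_space (R : realType) := AppSpace {
  app_car :> Type;
  app_dist : app_car -> set app_car -> ennreal R;
  app_dist1 : forall x, enn (app_dist x [set x]) = 0%E;
  app_dist0 : forall x, enn (app_dist x set0) = +oo%E;
  app_distU : forall x A B,
    enn (app_dist x (A `|` B)) =
    Order.min (enn (app_dist x A)) (enn (app_dist x B));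
  app_dist_enlarge : forall x A (e : ennreal R),
    (enn (app_dist x A) <=
     enn (app_dist x [set y | (enn (app_dist y A) <= enn e)%E]) + enn e)%E
}.

Definition contractive (R : realType) (X Y : app_space R) (f : X -> Y) : Prop :=
  forall x A, (enn (app_dist (f x) (f @` A)) <= enn (app_dist x A))%E.

Definition app_hom (R : realType) (X Y : app_space R) : Type :=
  {f : X -> Y | contractive f}.

Lemma contractive_id (R : realType) (X : app_space R) :
  contractive (@id X).
Proof. by move=> x A; rewrite image_id. Qed.

Lemma contractive_comp (R : realType) (X Y Z : app_space R)
    (g : app_hom Y Z) (f : app_hom X Y) :
  contractive (sval g \o sval f).
Proof.
case: g f => [g gP] [f fP] x A /=.
by rewrite -image_comp; apply: le_trans (gP _ _) (fP _ _).
Qed.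

Definition app_id (R : realType) (X : app_space R) : app_hom X X :=
  exist _ _ (@contractive_id R X).

Definition app_comp (R : realType) (X Y Z : app_space R)
    (g : app_hom Y Z) (f : app_hom X Y) : app_hom X Z :=
  exist _ _ (contractive_comp g f).

Lemma app_compA (R : realType) (X Y Z W : app_space R) (h : app_hom Z W)
    (g : app_hom Y Z) (f : app_hom X Y) :
  app_comp h (app_comp g f) = app_comp (app_comp h g) f.
Proof. exact: eq_exist. Qed.

Lemma app_comp1m (R : realType) (X Y : app_space R) (f : app_hom X Y) :
  app_comp (app_id Y) f = f.
Proof. by case: f => f fP; apply: eq_exist. Qed.

Lemma app_compm1 (R : realType) (X Y : app_space R) (f : app_hom X Y) :
  app_comp f (app_id X) = f.
Proof. by case: f => f fP; apply: eq_exist. Qed.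

Definition App (R : realType) : category :=
  Category (@app_compA R) (@app_comp1m R) (@app_compm1 R).

Definition in01 (R : realType) (f : ennreal R -> R) : Prop :=
  forall a, 0 <= f a <= 1.

(* For b = 0 the set is empty, and the library's [sup set0 = 0] is the
   supremum of the empty set in [0, 1]. *)
Definition left_cont (R : realType) (f : ennreal R -> R) : Prop :=
  forall b, f b = sup [set f a | a in [set a | (enn a < enn b)%E]].

Record Delta (R : realType) := MkDelta {
  Delta_fun :> ennreal R -> R;
  Delta_in01 : in01 Delta_fun;
  Delta_left_cont : left_cont Delta_fun
}.

Definition dle (R : realType) (f g : Delta R) : Prop := forall a, f a <= g a.

Lemma in01_has_ubound (R : realType) (f : ennreal R -> R) (S : set (ennreal R)) :
  in01 f -> has_ubound [set f a | a in S].
Proof. by move=> f01; exists 1 => _ [a _ <-]; case/andP: (f01 a). Qed.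

Lemma left_cont_intro (R : realType) (f : ennreal R -> R) : in01 f ->
  (forall a b, (enn a <= enn b)%E -> f a <= f b) ->
  (forall b e, 0 <= e -> e < f b ->
    exists2 a, (enn a < enn b)%E & e < f a) ->
  left_cont f.
Proof.
move=> f01 fmono fapx b; set S := [set f a | a in _].
have Sub : has_ubound S by apply: in01_has_ubound.
apply/eqP; rewrite eq_le; apply/andP; split; last first.
  have [->|/set0P S0] := eqVneq S set0.
    by rewrite sup0; case/andP: (f01 b).
  by apply: ge_sup => // _ [a ab <-]; apply/fmono/ltW.
have S_ge0 : 0 <= sup S.
  have [->|/set0P [s Ss]] := eqVneq S set0; first by rewrite sup0.
  apply: le_trans (ub_le_sup Sub Ss).
  by case: Ss => a _ <-; case/andP: (f01 a).
rewrite leNgt; apply/negP => /(fapx _ _ S_ge0)[a ab].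
by rewrite ltNge => /negP; apply; apply: ub_le_sup => //; exists a.
Qed.

Lemma Delta_mono (R : realType) (f : Delta R) a b :
  (enn a <= enn b)%E -> f a <= f b.
Proof.
rewrite le_eqVlt => /orP[/eqP/enn_inj -> //|ab].
rewrite [leRHS](Delta_left_cont f).
apply: ub_le_sup; last by exists a.
by apply: in01_has_ubound; apply: Delta_in01.
Qed.

Lemma Delta_approx (R : realType) (f : Delta R) b e : 0 <= e -> e < f b ->
  exists2 a, (enn a < enn b)%E & e < f a.
Proof.
move=> e0; rewrite (Delta_left_cont f); set S := [set f a | a in _].
have [->|/set0P S0] := eqVneq S set0; first by rewrite sup0 ltNge e0.
by move/(sup_gt S0) => [_ [a ab <-]] eb; exists a.
Qed.

Lemma Delta_ge0 (R : realType) (f : Delta R) a : 0 <= f a.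
Proof. by case/andP: (Delta_in01 f a). Qed.

Lemma Delta_le1 (R : realType) (f : Delta R) a : f a <= 1.
Proof. by case/andP: (Delta_in01 f a). Qed.

Definition dbot_fun (R : realType) (_ : ennreal R) : R := 0.

Lemma dbot_in01 (R : realType) : in01 (@dbot_fun R).
Proof. by move=> a; rewrite lexx ler01. Qed.

Lemma dbot_left_cont (R : realType) : left_cont (@dbot_fun R).
Proof.
apply: left_cont_intro => //; first exact: dbot_in01.
by move=> b e e0; rewrite /dbot_fun ltNge e0.
Qed.

Definition dbot (R : realType) : Delta R :=
  MkDelta (@dbot_in01 R) (@dbot_left_cont R).

Definition kappa_fun (R : realType) (a : ennreal R) : R :=
  if enn a == 0%E then 0 else 1.

Lemma kappa_in01 (R : realType) : in01 (@kappa_fun R).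
Proof. by move=> a; rewrite /kappa_fun; case: ifP; rewrite ?lexx ?ler01. Qed.

Lemma kappa_left_cont (R : realType) : left_cont (@kappa_fun R).
Proof.
apply: left_cont_intro; first exact: kappa_in01.
  move=> a b ab; rewrite /kappa_fun; case: (eqVneq (enn b)) => [b0|_].
    have -> // : enn a == 0%E.
    by rewrite eq_le -{1}b0 ab enn_ge0.
  by case: ifP.
move=> b e e0; rewrite /kappa_fun; case: (eqVneq (enn b)) => [_|b0 e1].
  by rewrite ltNge e0.
have : (0 < enn b)%E by rewrite lt_neqAle eq_sym b0 enn_ge0.
case E : (enn b) => [r| |//].
  rewrite lte_fin => r0.
  have h : (0 <= (r / 2)%:E)%E by rewrite lee_fin; lra.
  exists (ENNReal h); first by rewrite /= lte_fin; lra.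
  by rewrite /= eqe; case: eqP => //; lra.
move=> _; have h : (0 <= (1 : R)%:E)%E by rewrite lee_fin.
exists (ENNReal h); first by rewrite /= ltry.
by rewrite /= eqe oner_eq0.
Qed.

Definition kappa (R : realType) : Delta R :=
  MkDelta (@kappa_in01 R) (@kappa_left_cont R).

Definition djoin_fun (R : realType) (f g : Delta R) (a : ennreal R) : R :=
  Order.max (f a) (g a).

Lemma djoin_in01 (R : realType) (f g : Delta R) : in01 (djoin_fun f g).
Proof. by move=> a; rewrite le_max ge_max Delta_ge0 !Delta_le1. Qed.

Lemma djoin_left_cont (R : realType) (f g : Delta R) :
  left_cont (djoin_fun f g).
Proof.
apply: left_cont_intro; first exact: djoin_in01.
  move=> a b ab; rewrite /djoin_fun ge_max !le_max.
  by rewrite !(Delta_mono _ ab) orbT.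
move=> b e e0; rewrite lt_max => /orP[] /(Delta_approx e0)[a ab ea];
  by exists a => //; rewrite lt_max ea ?orbT.
Qed.

Definition djoin (R : realType) (f g : Delta R) : Delta R :=
  MkDelta (djoin_in01 f g) (djoin_left_cont f g).

Lemma djoin_lub (R : realType) (f g h : Delta R) :
  dle (djoin f g) h <-> dle f h /\ dle g h.
Proof.
split=> [fgh|[fh gh] a].
  by split=> a; apply: le_trans (fgh a); rewrite le_max lexx ?orbT.
by rewrite ge_max fh gh.
Qed.

Definition dotimes_fun (R : realType) (f g : Delta R) (c : ennreal R) : R :=
  sup [set f p.1 * g p.2 | p in
        [set p : ennreal R * ennreal R | (enn p.1 + enn p.2 <= enn c)%E]].

Lemma dotimes_set0 (R : realType) (f g : Delta R) (c : ennreal R) :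
  [set f p.1 * g p.2 | p in
    [set p : ennreal R * ennreal R | (enn p.1 + enn p.2 <= enn c)%E]] !=set0.
Proof.
have h : (0 <= (0 : \bar R))%E by [].
pose z : ennreal R := ENNReal h.
by exists (f z * g z); exists (z, z) => //=; rewrite adde0 enn_ge0.
Qed.

Lemma Delta_mul_in01 (R : realType) (f g : Delta R) a b :
  0 <= f a * g b <= 1.
Proof.
by rewrite mulr_ge0 ?Delta_ge0 //= mulr_ile1 ?Delta_ge0 ?Delta_le1.
Qed.

Lemma dotimes_ub (R : realType) (f g : Delta R) (c : ennreal R) :
  has_ubound [set f p.1 * g p.2 | p in
    [set p : ennreal R * ennreal R | (enn p.1 + enn p.2 <= enn c)%E]].
Proof. by exists 1 => _ [p _ <-]; case/andP: (Delta_mul_in01 f g p.1 p.2). Qed.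

Lemma dotimes_in01 (R : realType) (f g : Delta R) : in01 (dotimes_fun f g).
Proof.
move=> c; apply/andP; split.
  have [s Ss] := dotimes_set0 f g c.
  apply: le_trans (ub_le_sup (dotimes_ub f g c) Ss).
  by case: Ss => p _ <-; case/andP: (Delta_mul_in01 f g p.1 p.2).
apply: ge_sup; first exact: dotimes_set0.
by move=> _ [p _ <-]; case/andP: (Delta_mul_in01 f g p.1 p.2).
Qed.

Lemma dotimes_left_cont (R : realType) (f g : Delta R) :
  left_cont (dotimes_fun f g).
Proof.
apply: left_cont_intro; first exact: dotimes_in01.
  move=> a b ab; apply: ge_sup; first exact: dotimes_set0.
  move=> _ [p pa <-]; apply: ub_le_sup; first exact: dotimes_ub.
  by exists p => //; apply: le_trans ab.
move=> c e e0 /(sup_gt (dotimes_set0 f g c))[_ [[a b] /= abc <-] lt_e].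
have gb0 : 0 < g b.
  rewrite lt_neqAle Delta_ge0 andbT; apply/eqP => gb.
  by move: lt_e; rewrite -gb mulr0 ltNge e0.
have [|a' a'a] := @Delta_approx _ f a (e / g b) (divr_ge0 e0 (ltW gb0)).
  by rewrite ltr_pdivrMr.
rewrite ltr_pdivrMr // => {}lt_e.
have fa0 : 0 < f a'.
  rewrite lt_neqAle Delta_ge0 andbT; apply/eqP => fa.
  by move: lt_e; rewrite -fa mul0r ltNge e0.
have [|b' b'b] := @Delta_approx _ g b (e / f a') (divr_ge0 e0 (ltW fa0)).
  by rewrite ltr_pdivrMr // mulrC.
rewrite ltr_pdivrMr // mulrC => {}lt_e.
have h : (0 <= enn a' + enn b')%E.
  by rewrite adde_ge0 ?enn_ge0.
exists (ENNReal h); first exact: lt_le_trans (lteD a'a b'b) abc.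
apply: lt_le_trans lt_e _; apply: ub_le_sup; first exact: dotimes_ub.
by exists (a', b') => /=.
Qed.

Definition dotimes (R : realType) (f g : Delta R) : Delta R :=
  MkDelta (dotimes_in01 f g) (dotimes_left_cont f g).

Record probapp_space (R : realType) := ProbAppSpace {
  papp_car :> Type;
  papp_dist : papp_car -> set papp_car -> Delta R;
  papp_dist1 : forall x, papp_dist x [set x] = kappa R;
  papp_dist0 : forall x, papp_dist x set0 = dbot R;
  papp_distU : forall x A B,
    papp_dist x (A `|` B) = djoin (papp_dist x A) (papp_dist x B);
  papp_dist_enlarge : forall x A (phi : Delta R),
    dle (dotimes (papp_dist x [set y | dle phi (papp_dist y A)]) phi)
        (papp_dist x A)
}.

Definition prob_contractive (R : realType) (X Y : probapp_space R)
    (f : X -> Y) : Prop :=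
  forall x A, dle (papp_dist x A) (papp_dist (f x) (f @` A)).

Definition probapp_hom (R : realType) (X Y : probapp_space R) : Type :=
  {f : X -> Y | prob_contractive f}.

Lemma prob_contractive_id (R : realType) (X : probapp_space R) :
  prob_contractive (@id X).
Proof. by move=> x A a; rewrite image_id. Qed.

Lemma prob_contractive_comp (R : realType) (X Y Z : probapp_space R)
    (g : probapp_hom Y Z) (f : probapp_hom X Y) :
  prob_contractive (sval g \o sval f).
Proof.
case: g f => [g gP] [f fP] x A a /=.
by rewrite -image_comp; apply: le_trans (fP _ _ _) (gP _ _ _).
Qed.

Definition probapp_id (R : realType) (X : probapp_space R) : probapp_hom X X :=
  exist _ _ (@prob_contractive_id R X).

Definition probapp_comp (R : realType) (X Y Z : probapp_space R)
    (g : probapp_hom Y Z) (f : probapp_hom X Y) : probapp_hom X Z :=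
  exist _ _ (prob_contractive_comp g f).

Lemma probapp_compA (R : realType) (X Y Z W : probapp_space R)
    (h : probapp_hom Z W) (g : probapp_hom Y Z) (f : probapp_hom X Y) :
  probapp_comp h (probapp_comp g f) = probapp_comp (probapp_comp h g) f.
Proof. exact: eq_exist. Qed.

Lemma probapp_comp1m (R : realType) (X Y : probapp_space R)
    (f : probapp_hom X Y) :
  probapp_comp (probapp_id Y) f = f.
Proof. by case: f => f fP; apply: eq_exist. Qed.

Lemma probapp_compm1 (R : realType) (X Y : probapp_space R)
    (f : probapp_hom X Y) :
  probapp_comp f (probapp_id X) = f.
Proof. by case: f => f fP; apply: eq_exist. Qed.

Definition ProbApp (R : realType) : category :=
  Category (@probapp_compA R) (@probapp_comp1m R) (@probapp_compm1 R).

(* Main.v *)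
Require Import Defs.
From mathcomp Require Import all_boot all_order all_algebra.
From mathcomp Require Import all_classical all_reals.
From mathcomp Require Import ereal lra.

(** The embedding post-composes distances with the step functions [step a],
    where [step a b] is [1] if [a < b] and [0] otherwise.  The assignment
    [a |-> step a] from [0, oo] with the reverse order to [Delta] has a right
    adjoint [phi |-> inf {b | phi b = 1}], which is lax monoidal, so
    post-composition with it is the coreflector.  Its left adjoint is
    [phi |-> inf {b | 0 < phi b}]; post-composing with this one may violate the
    enlargement axiom, so the reflection is instead generated by functions: the
    reflected distance from [x] to [A] is the supremum of the values at [x] of
    the contractive functionals on the space that are nonpositive on [A]. *)

Set Implicit Arguments.
Unset Strict Implicit.
Unset Printing Implicit Defensive.

Import Order.TTheory GRing.Theory Num.Theory.
Local Open Scope classical_set_scope.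
Local Open Scope ring_scope.

(** * Density of the extended half-line and extensionality in [Delta] *)

Lemma enn_dense (R : realType) (a b : ennreal R) : (enn a < enn b)%E ->
  exists2 c : ennreal R, (enn a < enn c)%E & (enn c < enn b)%E.
Proof.
case: a b => [[a| |//] a0] [[b| |//] b0] //=; rewrite ?lte_fin => ab.
- have h : (0 <= ((a + b) / 2)%:E)%E.
    by move: a0 b0; rewrite !lee_fin; lra.
  by exists (ENNReal h); rewrite /= lte_fin; lra.
- have h : (0 <= (a + 1)%:E)%E by move: a0; rewrite !lee_fin; lra.
  by exists (ENNReal h); rewrite /= ?ltry// lte_fin; lra.
Qed.

Lemma Delta_ext (R : realType) (f g : Delta R) : f =1 g -> f = g.
Proof.
case: f g => [f f01 fl] [g g01 gl] /= /funext fg.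
case: _ / fg g01 gl => g01 gl.
by congr MkDelta; apply: Prop_irrelevance.
Qed.

(** * Step functions, thresholds and the Galois connection between them *)

Section Step.
Context {R : realType}.
Implicit Types (a b e : ennreal R) (phi psi : Delta R).

(** The strict inequality gives left continuity, and makes [step] send zero to [kappa] and infinity
    to [dbot]. *)
Definition step_fun a b : R := if (enn a < enn b)%E then 1 else 0.

Lemma step_in01 a : in01 (step_fun a).
Proof. by move=> b; rewrite /step_fun; case: ifP; rewrite ?lexx ?ler01. Qed.

Lemma step_left_cont a : left_cont (step_fun a).
Proof.
apply: left_cont_intro; first exact: step_in01.
  move=> b c bc; rewrite /step_fun; case: ifPn => [ab|_].
    by rewrite (lt_le_trans ab bc).
  by case: ifP.
move=> b e e0; rewrite /step_fun; case: ifPn => [ab e1|_]; last first.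
  by rewrite ltNge e0.
by have [c ac cb] := enn_dense ab; exists c; rewrite ?ac.
Qed.

Definition step a : Delta R := MkDelta (step_in01 a) (step_left_cont a).

Lemma step_gt0 a b : (0 < step a b) = (enn a < enn b)%E.
Proof. by rewrite /= /step_fun; case: ifP; rewrite ?ltr01 ?ltxx. Qed.

Lemma step1 a b : (enn a < enn b)%E -> step a b = 1.
Proof. by rewrite /= /step_fun => ->. Qed.

(** A step takes only the values 0 and 1, so only the support of [phi] matters. This expresses the
    left adjoint of [step] without naming an infimum. *)
Lemma dle_stepP phi a :
  dle phi (step a) <-> (forall b, 0 < phi b -> (enn a < enn b)%E).
Proof.
split=> [le_phi b phib|lt_a b].
  by rewrite -step_gt0 (lt_le_trans phib).
have [phib|] := ltP 0 (phi b); first by rewrite step1 ?lt_a ?Delta_le1.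
by move=> /le_trans; apply; apply: Delta_ge0.
Qed.

Lemma dle_step a b : dle (step a) (step b) <-> (enn b <= enn a)%E.
Proof.
rewrite dle_stepP; split=> [h|ba c]; last by rewrite step_gt0; exact: le_lt_trans.
(* A point [c] strictly between [a] and [b] separates the two steps. *)
rewrite leNgt; apply/negP => ab; have [c ac cb] := enn_dense ab.
by have := h c; rewrite step_gt0 => /(_ ac); rewrite ltNge (ltW cb).
Qed.

(** The empty infimum is [+oo], the threshold of a [phi] that never attains 1. *)
Definition thr phi : \bar R := ereal_inf [set enn b | b in [set b | phi b = 1]].

Lemma thr_ge0 phi : (0 <= thr phi)%E.
Proof. by apply: le_ereal_inf_tmp => _ [b _ <-]; apply: enn_ge0. Qed.

Definition threshold phi : ennreal R := ENNReal (thr_ge0 phi).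

Lemma threshold_le phi b : phi b = 1 -> (enn (threshold phi) <= enn b)%E.
Proof. by move=> phib; apply: ereal_inf_lbound; exists b. Qed.

Lemma threshold_leP phi a : (enn (threshold phi) <= enn a)%E <-> dle (step a) phi.
Proof.
split=> [le_a b|h]; last first.
  (* A point [b] strictly between [a] and the threshold would satisfy [step a b = 1], hence
     [phi b = 1], although it lies below the infimum. *)
  rewrite leNgt; apply/negP => /enn_dense[b ab]; rewrite ltNge => /negP; apply.
  apply: threshold_le; apply/eqP; rewrite eq_le Delta_le1 /=.
  by have := h b; rewrite step1.
have [ab|/negbTE ab] := boolP (enn a < enn b)%E; last first.
  by rewrite /= /step_fun ab Delta_ge0.
have /ereal_inf_lt[_ [c phic <-] cb] := le_lt_trans le_a ab.
by rewrite step1// -phic; apply/Delta_mono/ltW.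
Qed.

Lemma stepK : cancel step threshold.
Proof.
move=> a; apply: enn_inj; apply/eqP; rewrite eq_le; apply/andP; split.
  by apply/threshold_leP.
by apply/dle_step/threshold_leP.
Qed.

Lemma threshold_anti phi psi : dle phi psi ->
  (enn (threshold psi) <= enn (threshold phi))%E.
Proof.
move=> le_phi; apply/threshold_leP => a; apply: le_trans (le_phi a).
exact: (threshold_leP _ _).1.
Qed.

(** A maximum equals 1 only if one of its two arguments does. *)
Lemma threshold_join phi psi : enn (threshold (djoin phi psi)) =
  Order.min (enn (threshold phi)) (enn (threshold psi)).
Proof.
apply/eqP; rewrite eq_le le_min; apply/andP; split.
  by rewrite !threshold_anti// => a; rewrite /= le_max lexx ?orbT.
apply: le_ereal_inf_tmp => _ [b /= + <-]; rewrite /djoin_fun ge_min.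
by case: (leP (phi b) (psi b)) => _ phib; rewrite (threshold_le phib) ?orbT.
Qed.

Lemma mul_le_dotimes phi psi a b c : (enn a + enn b <= enn c)%E ->
  phi a * psi b <= dotimes phi psi c.
Proof.
by move=> abc; apply: ub_le_sup; [exact: dotimes_ub|exists (a, b)].
Qed.

(** For finite [e] and [phi b = 1], the product attains 1 at [b + e + d] for every [d > 0]. The
    margin [d] is needed because [step e] still vanishes at [e]; it then tends to 0. *)
Lemma threshold_dotimes phi e :
  (enn (threshold (dotimes phi (step e))) <= enn (threshold phi) + enn e)%E.
Proof.
case: e => [[r| |//] r0]; last first.
  by rewrite /= addey ?leey// gt_eqF// (lt_le_trans _ (thr_ge0 _)) ?ltNy0.
rewrite -leeBlDr//; apply: le_ereal_inf_tmp => _ [b phib <-].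
rewrite leeBlDr//; apply/lee_addgt0Pr => d d0.
have h : (0 <= (r + d)%:E)%E by move: r0; rewrite !lee_fin; lra.
have h' : (0 <= enn b + (r + d)%:E)%E by rewrite adde_ge0// enn_ge0.
rewrite -addeA -EFinD -[leRHS]/(enn (ENNReal h')); apply: threshold_le.
apply/eqP; rewrite eq_le Delta_le1 /=.
apply: le_trans (mul_le_dotimes _ _ (a := b) (b := ENNReal h) _) => //.
by rewrite phib step1 ?mul1r //= lte_fin; lra.
Qed.

End Step.

(** * Elementary facts on approach spaces *)

Lemma app_space_eq (R : realType) (T : Type) (d d' : T -> set T -> ennreal R)
    d1 d0 dU de d1' d0' dU' de' : d = d' ->
  @AppSpace R T d d1 d0 dU de = @AppSpace R T d' d1' d0' dU' de'.
Proof.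
move=> dd'; case: _ / dd' in d1' d0' dU' de' *.
by congr AppSpace; apply: Prop_irrelevance.
Qed.

Lemma app_dist_anti (R : realType) (X : app_space R) (x : X) (A B : set X) :
  A `<=` B -> (enn (app_dist x B) <= enn (app_dist x A))%E.
Proof. by move=> AB; rewrite -(setUidr AB) app_distU ge_min lexx. Qed.

Lemma app_dist_in (R : realType) (X : app_space R) (x : X) (A : set X) :
  A x -> enn (app_dist x A) = 0%E.
Proof.
move=> Ax; apply/eqP; rewrite eq_le enn_ge0 andbT -(app_dist1 x).
by apply: app_dist_anti => _ ->.
Qed.

(** * The full and faithful embedding *)

Section Embedding.
Context {R : realType}.

Section Object.
Variable X : app_space R.
Let d (x : X) A := step (app_dist x A).

Lemma emb_dist1 x : d x [set x] = kappa R.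
Proof.
apply: Delta_ext => a; rewrite /d /= /step_fun /kappa_fun app_dist1.
by rewrite lt_neqAle enn_ge0 andbT eq_sym; case: eqP.
Qed.

Lemma emb_dist0 x : d x set0 = dbot R.
Proof.
by apply: Delta_ext => a; rewrite /d /= /step_fun app_dist0 ltNge leey.
Qed.

Lemma emb_distU x A B : d x (A `|` B) = djoin (d x A) (d x B).
Proof.
apply: Delta_ext => a; rewrite /d /= /djoin_fun /= /step_fun app_distU gt_min.
case: (_ < _)%E; case: (_ < _)%E => /=;
  by rewrite ?maxxx ?(max_l ler01) ?(max_r ler01).
Qed.

(** A positive product at [c] has both factors positive at some [a] and [b] with [a + b <= c].
    Positivity of [phi] at a point bounds the distance to [A] on the whole [phi]-enlargement, so the
    enlargement axiom of [X] applies. *)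
Lemma emb_dist_enlarge x A (phi : Delta R) :
  dle (dotimes (d x [set y | dle phi (d y A)]) phi) (d x A).
Proof.
apply/dle_stepP => c.
move=> /(sup_gt (dotimes_set0 _ _ c))[_ [[a b] /= abc <-]] prod_gt0.
have phib0 : 0 < phi b.
  rewrite lt_neqAle Delta_ge0 andbT; apply/eqP => phib.
  by move: prod_gt0; rewrite -phib mulr0 ltxx.
have da : (enn (app_dist x [set y | dle phi (d y A)]) < enn a)%E.
  by move: prod_gt0; rewrite pmulr_lgt0// -step_gt0.
(* Passing to [b' < b] makes both summands strict, so the sum stays strict even when [b] is
   infinite. *)
have [b' b'b phib'0] := Delta_approx (lexx 0) phib0.
apply: lt_le_trans abc; apply: le_lt_trans (lteD da b'b).
apply: le_trans (app_dist_enlarge x A b') _; apply: leeD2r.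
by apply: app_dist_anti => y /dle_stepP/(_ _ phib'0)/ltW.
Qed.

Definition emb : probapp_space R :=
  ProbAppSpace emb_dist1 emb_dist0 emb_distU emb_dist_enlarge.

End Object.

Lemma emb_contractive (X Y : app_space R) (f : X -> Y) :
  @prob_contractive R (emb X) (emb Y) f <-> contractive f.
Proof. by split=> h x A; [apply/dle_step/h|exact/dle_step/h]. Qed.

Definition emb_hom (X Y : app_space R) (f : app_hom X Y) :
    probapp_hom (emb X) (emb Y) :=
  exist _ (sval f) ((emb_contractive (sval f)).2 (svalP f)).

Lemma emb_hom1 X : emb_hom (app_id X) = probapp_id (emb X).
Proof. exact: eq_exist. Qed.

Lemma emb_homM X Y Z (g : app_hom Y Z) (f : app_hom X Y) :
  emb_hom (app_comp g f) = probapp_comp (emb_hom g) (emb_hom f).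
Proof. exact: eq_exist. Qed.

Definition Emb : functor (App R) (ProbApp R) :=
  @Functor (App R) (ProbApp R) emb emb_hom emb_hom1 emb_homM.

Lemma Emb_full : full Emb.
Proof.
move=> X Y [g gP]; exists (exist _ g ((emb_contractive g).1 gP)).
exact: eq_exist.
Qed.

Lemma Emb_faithful : faithful Emb.
Proof. by move=> X Y [f fP] [g gP] [fg]; apply: eq_exist. Qed.

End Embedding.

(** * The right adjoint, by thresholds *)

Section Coreflection.
Context {R : realType}.

Section Object.
Variable X : probapp_space R.
Let d (x : X) A := threshold (papp_dist x A).

Lemma corefl_dist1 x : enn (d x [set x]) = 0%E.
Proof.
apply/eqP; rewrite eq_le enn_ge0 andbT /d papp_dist1.
apply: (threshold_leP _ (ENNReal (lexx 0%E))).2 => a /=.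
rewrite /step_fun /kappa_fun /= lt_neqAle enn_ge0 andbT eq_sym.
by case: eqP.
Qed.

Lemma corefl_dist0 x : enn (d x set0) = +oo%E.
Proof.
rewrite /d papp_dist0; apply/eqP; rewrite -leye_eq.
by apply: le_ereal_inf_tmp => _ [a /= /esym/eqP + <-]; rewrite oner_eq0.
Qed.

Lemma corefl_distU x A B :
  enn (d x (A `|` B)) = Order.min (enn (d x A)) (enn (d x B)).
Proof. by rewrite /d papp_distU threshold_join. Qed.

(** By the Galois connection, the enlargement of [A] by [e] is its probabilistic enlargement by
    [step e]; the axiom of [X] and lax monoidality of [threshold] conclude. *)
Lemma corefl_dist_enlarge x A (e : ennreal R) :
  (enn (d x A) <= enn (d x [set y | (enn (d y A) <= enn e)%E]) + enn e)%E.
Proof.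
apply: le_trans (threshold_dotimes _ _); apply: threshold_anti.
have -> : [set y | (enn (d y A) <= enn e)%E] =
          [set y | dle (step e) (papp_dist y A)].
  by apply/seteqP; split=> y /threshold_leP.
exact: papp_dist_enlarge.
Qed.

Definition corefl : app_space R :=
  AppSpace corefl_dist1 corefl_dist0 corefl_distU corefl_dist_enlarge.

End Object.

Lemma corefl_contractive (X Y : probapp_space R) (f : probapp_hom X Y) :
  @contractive R (corefl X) (corefl Y) (sval f).
Proof. by move=> x A; apply/threshold_anti/(svalP f). Qed.

Definition corefl_hom (X Y : probapp_space R) (f : probapp_hom X Y) :
    app_hom (corefl X) (corefl Y) :=
  exist _ (sval f) (corefl_contractive f).

Lemma corefl_hom1 X : corefl_hom (probapp_id X) = app_id (corefl X).
Proof. exact: eq_exist. Qed.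

Lemma corefl_homM X Y Z (g : probapp_hom Y Z) (f : probapp_hom X Y) :
  corefl_hom (probapp_comp g f) = app_comp (corefl_hom g) (corefl_hom f).
Proof. exact: eq_exist. Qed.

Definition Corefl : functor (ProbApp R) (App R) :=
  @Functor (ProbApp R) (App R) corefl corefl_hom corefl_hom1 corefl_homM.

(** This is [threshold_leP] applied at each point and subset. The adjunction bijection thus leaves
    underlying maps unchanged. *)
Lemma corefl_universal (X : app_space R) (Y : probapp_space R) (f : X -> Y) :
  @prob_contractive R (emb X) Y f <-> @contractive R X (corefl Y) f.
Proof. by split=> h x A; apply/threshold_leP/h. Qed.

Lemma Emb_Corefl_adjoint : adjoint Emb Corefl.
Proof.
exists (fun (X : App R) (Y : ProbApp R) (f : Defs.hom (Emb X) Y) =>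
  exist _ (sval f) ((corefl_universal (sval f)).1 (svalP f)) :
  Defs.hom X (Corefl Y)).
split=> [X Y|X X' Y Y' h k f]; last exact: eq_exist.
exists (fun f : app_hom X (corefl Y) =>
  exist _ (sval f) ((corefl_universal (sval f)).2 (svalP f)) :
  probapp_hom (emb X) Y) => -[f fP]; exact: eq_exist.
Qed.

(** A left inverse on objects, strict and not just up to isomorphism, gives injectivity of the
    embedding. *)
Lemma embK : cancel (@emb R) corefl.
Proof.
case=> X d d1 d0 dU de; apply: app_space_eq.
by apply/funext => x; apply/funext => A; exact: stepK.
Qed.

End Coreflection.

(** * The left adjoint, by contractive functionals *)

Section Reflection.
Context {R : realType}.

(* Contractivity into [0, oo] with distance [max (x - sup A) 0], stated for
   the distance [inf {b | 0 < papp_dist x A b}] without naming [sup] or [inf]. *)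
Definition functional (X : probapp_space R) (f : X -> \bar R) : Prop :=
  forall x A (e b : ennreal R), (forall y, A y -> (f y <= enn e)%E) ->
    0 < papp_dist x A b -> (f x <= enn b + enn e)%E.

Section Object.
Variable X : probapp_space R.
Implicit Types (x y : X) (A B : set X) (f g : X -> \bar R).

(** The constant 0 makes [rdist] nonnegative, and the constant [+oo] gives the distance to the empty
    set. *)
Lemma functional_cst (c : \bar R) : functional (fun _ : X => c).
Proof.
move=> x A e b Ae; have [->|/set0P[y Ay] _] := eqVneq A set0.
  by rewrite papp_dist0 /= /dbot_fun ltxx.
by apply: le_trans (Ae _ Ay) _; rewrite leeDr// enn_ge0.
Qed.

(** Split [A] according to which of [f] and [g] is smaller; a positive join is positive for one of
    the pieces. The union axiom of the reflection rests on this closure. *)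
Lemma functional_min f g : functional f -> functional g ->
  functional (fun x => Order.min (f x) (g x)).
Proof.
move=> ff fg x A e b Ae.
have -> : A = [set y | A y /\ (f y <= g y)%E] `|` [set y | A y /\ (g y <= f y)%E].
  apply/seteqP; split=> y /= => [Ay|[] []//].
  by case/orP: (le_total (f y) (g y)); [left|right].
rewrite papp_distU /= lt_max ge_min => /orP[] Ab.
  by rewrite (ff _ _ e _ _ Ab)// => y [/Ae + fgy]; rewrite min_l.
by rewrite (fg _ _ e _ _ Ab) ?orbT// => y [/Ae + gfy]; rewrite min_r.
Qed.

(** The bound [e] on [A] for the shifted map is the bound [e + r] for [f]. *)
Lemma functional_sub f (r : R) : 0 <= r -> functional f ->
  functional (fun x => (f x - r%:E)%E).
Proof.
move=> r0 ff x A e b Ae Ab; rewrite leeBlDr// -addeA.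
have h : (0 <= enn e + r%:E)%E by rewrite adde_ge0// enn_ge0.
by apply: (ff x A (ENNReal h)) Ab => y /Ae; rewrite leeBlDr.
Qed.

Definition rdist x A : \bar R := ereal_sup
  [set f x | f in [set f | functional f /\ forall y, A y -> (f y <= 0)%E]].

Lemma le_rdist x A f : functional f -> (forall y, A y -> (f y <= 0)%E) ->
  (f x <= rdist x A)%E.
Proof. by move=> ff Af; apply: ereal_sup_ubound; exists f. Qed.

Lemma rdist_leP x A (c : \bar R) : (rdist x A <= c)%E <->
  (forall f, functional f -> (forall y, A y -> (f y <= 0)%E) -> (f x <= c)%E).
Proof.
split=> [le_c f ff Af|h]; first exact: le_trans (le_rdist _ _ _) le_c.
by apply: ge_ereal_sup => _ [f [ff Af] <-]; apply: h.
Qed.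

Lemma rdist_ge0 x A : (0 <= rdist x A)%E.
Proof. by apply: (le_rdist x (@functional_cst 0)). Qed.

Let d x A := ENNReal (rdist_ge0 x A).

Lemma refl_dist1 x : enn (d x [set x]) = 0%E.
Proof.
apply/eqP; rewrite eq_le enn_ge0 andbT /=.
by apply/rdist_leP => f _; apply.
Qed.

Lemma refl_dist0 x : enn (d x set0) = +oo%E.
Proof.
by apply/eqP; rewrite -leye_eq; apply: (le_rdist x (@functional_cst +oo%E)).
Qed.

Lemma refl_distU x A B :
  enn (d x (A `|` B)) = Order.min (enn (d x A)) (enn (d x B)).
Proof.
apply/eqP; rewrite eq_le; apply/andP; split.
  rewrite le_min; apply/andP; split; apply/rdist_leP => f ff ABf;
    apply: le_rdist => // y ?; apply: ABf; first by left.
  by right.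
(* Otherwise functionals [f] and [g] witness that both distances exceed the one to the union; their
   minimum is nonpositive on the union and exceeds it too. *)
rewrite leNgt lt_min; apply/negP.
move=> /andP[/ereal_sup_gt[_ [f [ff Af] <-] ltf]].
move=> /ereal_sup_gt[_ [g [fg Bg] <-] ltg].
have : (Order.min (f x) (g x) <= rdist x (A `|` B))%E.
  apply: (le_rdist x (functional_min ff fg)) => y; rewrite ge_min.
  by move=> [/Af ->|/Bg ->]; rewrite ?orbT.
by rewrite leNgt lt_min ltf ltg.
Qed.

Lemma refl_dist_enlarge x A (e : ennreal R) :
  (enn (d x A) <= enn (d x [set y | (enn (d y A) <= enn e)%E]) + enn e)%E.
Proof.
case: e => [[r| |//] r0]; last first.
  by rewrite /= addey ?leey// gt_eqF// (lt_le_trans _ (rdist_ge0 _ _)) ?ltNy0.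
apply/rdist_leP => f ff Af; rewrite /= -leeBlDr//.
have r_ge0 : 0 <= r by rewrite -lee_fin.
(* Where the distance to [A] is at most [r], also [f] is at most [r], so [f - r] competes in the
   supremum for the enlarged set. *)
apply: (le_rdist x (functional_sub r_ge0 ff)) => y le_r.
by rewrite leeBlDr// add0e; apply: le_trans (le_rdist _ _ _) le_r.
Qed.

Definition refl : app_space R :=
  AppSpace refl_dist1 refl_dist0 refl_distU refl_dist_enlarge.

Lemma rdist_le x A (b : ennreal R) : 0 < papp_dist x A b ->
  (rdist x A <= enn b)%E.
Proof.
move=> Ab; apply/rdist_leP => f ff Af; rewrite -[leRHS]adde0.
exact: (ff x A (ENNReal (lexx 0%E)) b Af Ab).
Qed.

End Object.

Lemma refl_universal (X : probapp_space R) (Y : app_space R) (h : X -> Y) :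
  @contractive R (refl X) Y h <-> @prob_contractive R X (emb Y) h.
Proof.
split=> hP x A.
  (* Left continuity supplies the strict inequality that [rdist_le] alone does not give. *)
  apply/dle_stepP => b /(Delta_approx (lexx 0))[a ab Aa].
  by apply: le_lt_trans ab; apply: le_trans (hP _ _) (rdist_le Aa).
(* The distance to the image of [A], pulled back along [h], vanishes on [A] and is a functional by
   the enlargement axiom of [Y]; hence it is below the supremum [rdist]. *)
pose f y := enn (app_dist (h y) (h @` A)).
apply: (@le_rdist X x A f) => [z B e b Be Bb|y Ay]; last first.
  by rewrite /f app_dist_in//; exists y.
apply: le_trans (app_dist_enlarge _ _ e) _; apply: leeD2r.
have /dle_stepP/(_ _ Bb)/ltW := hP z B; apply: le_trans.
by apply: app_dist_anti => _ [y By <-]; apply: Be.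
Qed.

(** Functionals pull back along contractive maps. *)
Lemma refl_contractive (X Y : probapp_space R) (h : probapp_hom X Y) :
  @contractive R (refl X) (refl Y) (sval h).
Proof.
case: h => h hP x A /=; apply/rdist_leP => f ff Af.
apply: (@le_rdist X x A (f \o h)) => [z B e b Be Bb|y Ay] /=.
  apply: (ff _ (h @` B)) => [_ [y By <-]|]; first exact: Be.
  exact: lt_le_trans Bb (hP _ _ _).
by apply: Af; exists y.
Qed.

Definition refl_hom (X Y : probapp_space R) (f : probapp_hom X Y) :
    app_hom (refl X) (refl Y) :=
  exist _ (sval f) (refl_contractive f).

Lemma refl_hom1 X : refl_hom (probapp_id X) = app_id (refl X).
Proof. exact: eq_exist. Qed.

Lemma refl_homM X Y Z (g : probapp_hom Y Z) (f : probapp_hom X Y) :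
  refl_hom (probapp_comp g f) = app_comp (refl_hom g) (refl_hom f).
Proof. exact: eq_exist. Qed.

Definition Refl : functor (ProbApp R) (App R) :=
  @Functor (ProbApp R) (App R) refl refl_hom refl_hom1 refl_homM.

Lemma Refl_Emb_adjoint : adjoint Refl Emb.
Proof.
exists (fun (X : ProbApp R) (Y : App R) (f : Defs.hom (Refl X) Y) =>
  exist _ (sval f) ((refl_universal (sval f)).1 (svalP f)) :
  Defs.hom X (Emb Y)).
split=> [X Y|X X' Y Y' h k f]; last exact: eq_exist.
exists (fun f : probapp_hom X (emb Y) =>
  exist _ (sval f) ((refl_universal (sval f)).2 (svalP f)) :
  app_hom (refl X) Y) => -[f fP]; exact: eq_exist.
Qed.

End Reflection.

Theorem corollary4p7 (R : realType) :
  exists F : functor (App R) (ProbApp R),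
    full F /\ faithful F /\ injective (fobj F) /\
    has_left_adjoint F /\ has_right_adjoint F.
Proof.
exists Emb; split; first exact: Emb_full.
split; first exact: Emb_faithful.
split; first exact: can_inj embK.
by split; [exists Refl; exact: Refl_Emb_adjoint
          |exists Corefl; exact: Emb_Corefl_adjoint].
Qed.
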